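(* Let $R$ be a principal ideal domain of odd or zero characteristic and let $D\ge 0$ be an integer. Let $\mathsf{V}$ be the standard hemispherical chain complex over $R$ of degree $D$. Let $\mathsf{W}$ be a chain complex of $R$-modules with a degree-preserving $\mathbb{Z}_2$-action given by an involution $\iota$, such that for each $j\in\mathbb{Z}$ we have $W_j=L_j\times L_j$ for a finitely generated $R$-module $L_j$, with $\iota(w_0,w_1)=(w_1,w_0)$ for all $(w_0,w_1)\in W_j$, and such that $L_j=0$ unless $0\le j\le D$. Then the following hold for every integer $i$. If $D$ is odd, then \[ H_i((\mathsf{V}\otimes\mathsf{W})^+)\cong H_i(\mathsf{W}^+)\oplus H_{i-D}(\mathsf{W}^+)\cong \begin{cases} H_i(\mathsf{W}^+) & \text{if } 0\le i\le D-1,\\ H_D(\mathsf{W}^+)\oplus H_0(\mathsf{W}^+) & \text{if } i=D,\\ H_{i-D}(\mathsf{W}^+) & \text{if } D+1\le i\le 2D,\\ 0 & \text{otherwise}. \end{cases} \] If $D$ is even, then \[ H_i((\mathsf{V}\otimes\mathsf{W})^+)\cong H_i(\mathsf{W}^+)\oplus H_{i-D}(\mathsf{W}^-)\cong \begin{cases} H_i(\mathsf{W}^+) & \text{if } 0\le i\le D-1,\\ H_D(\mathsf{W}^+)\oplus H_0(\mathsf{W}^-) & \text{if } i=D,\\ H_{i-D}(\mathsf{W}^-) & \text{if } D+1\le i\le 2D,\\ 0 & \text{otherwise}. \end{cases} \]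
   Context: A degree-preserving $\mathbb{Z}_2$-action on a chain complex $\mathsf{C}$ of $R$-modules is given by a degree-preserving involutive automorphism $\iota$ commuting with the boundary map $\partial$. For such $\mathsf{C}$, $\mathsf{C}^+$ is the quotient complex obtained by identifying $c$ with $0$ whenever $c+\iota(c)=0$, and $\mathsf{C}^-$ is the quotient complex obtained by identifying $c$ with $0$ whenever $c-\iota(c)=0$. The tensor product $\mathsf{V}\otimes\mathsf{W}$ over $R$ has $k$th chain group $\bigoplus_{i+j=k}V_i\otimes W_j$, boundary $\partial(v\otimes w)=\partial(v)\otimes w+(-1)^i v\otimes\partial(w)$ for $v\in V_i$, $w\in W_j$, and $\mathbb{Z}_2$-action $\iota(v\otimes w)=\iota(v)\otimes\iota(w)$. The standard hemispherical chain complex $\mathsf{V}$ over $R$ of degree $D$: for $0\le i\le D$, $V_i$ is the free $R$-module on two generators $\sigma_i^{+}=\sigma_i^{+1}$ and $\sigma_i^{-}=\sigma_i^{-1}$; $V_i=0$ for $i<0$ and $i>D$; the boundary is $\partial(\sigma_i^{\epsilon})=\sigma_{i-1}^{\epsilon}+(-1)^i\sigma_{i-1}^{-\epsilon}$ for $\epsilon=\pm1$ and $1\le i\le D$ (and $\partial(\sigma_0^\epsilon)=0$); the $\mathbb{Z}_2$-action interchanges $\sigma_i^+$ and $\sigma_i^-$. *)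

(* Defs.v *)
From HB Require Import structures.
From mathcomp Require Import all_boot all_order all_algebra.
From mathcomp Require Import boolp.
From mathcomp.multinomials Require Import freeg.

Set Implicit Arguments.
Unset Strict Implicit.
Unset Printing Implicit Defensive.

Import Order.TTheory GRing.Theory Num.Theory.
Local Open Scope ring_scope.
#[local] Obligation Tactic := idtac.

(* The ideals of R are the submodules of the regular module R^o. *)
Definition principal_ideal_domain (R : idomainType) : Prop :=
  forall I : submodClosed R^o,
  exists a : R, forall x : R, x \in I <-> exists r : R, x = r * a.

Definition has_characteristic (R : nzRingType) (n : nat) : Prop :=
  forall m : nat, m%:R = 0 :> R <-> (n %| m)%N.

Definition finitely_generated (R : nzRingType) (M : lmodType R) : Prop :=
  exists (n : nat) (g : 'I_n -> M),
  forall x : M, exists a : 'I_n -> R, x = \sum_(k < n) a k *: g k.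

Definition isomorphic (R : nzRingType) (M N : lmodType R) : Prop :=
  exists f : {linear M -> N}, bijective f.

Notation "M ~= N" := (isomorphic M N) (at level 70, no associativity).

Section Submodules.
Variables (R : nzRingType) (M : lmodType R).

Definition submod (S : submodClosed M) : Type := {x : M | x \in S}.

HB.instance Definition _ (S : submodClosed M) := SubChoice.on (submod S).
HB.instance Definition _ (S : submodClosed M) :=
  [SubChoice_isSubLmodule of submod S by <:].

Definition submod_span (A : M -> Prop) : {pred M} := fun x =>
  `[< forall S : submodClosed M, (forall a, A a -> a \in S) -> x \in S >].

Lemma submod_span_closed (A : M -> Prop) : submod_closed (submod_span A).
Proof.
split=> [|a x y /asboolP xA /asboolP yA]; apply/asboolP => S AS.
  exact: rpred0.
by rewrite rpredD ?rpredZ ?xA ?yA.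
Qed.

HB.instance Definition _ (A : M -> Prop) :=
  GRing.isSubmodClosed.Build R M (submod_span A) (submod_span_closed A).

Lemma mem_submod_span (A : M -> Prop) x : A x -> x \in submod_span A.
Proof. by move=> Ax; apply/asboolP => S; apply. Qed.

End Submodules.

Section QuotientModule.
Variables (R : nzRingType) (M : lmodType R) (S : submodClosed M).
Local Open Scope quotient_scope.

Fact submod_oppr : oppr_closed S.
Proof. by move=> x xS; rewrite -scaleN1r rpredZ. Qed.

Definition additive_of : zmodClosed M :=
  HB.pack (GRing.SubmodClosed.sort S)
    (GRing.isOppClosed.Build M (GRing.SubmodClosed.sort S) submod_oppr).

Definition quotmod : Type := Quotient.quot additive_of.

HB.instance Definition _ := GRing.Zmodule.on quotmod.
HB.instance Definition _ := Quotient.on quotmod.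

Definition qpi (x : M) : quotmod := \pi_(Quotient.quot additive_of) x.
Definition qrepr (x : quotmod) : M := repr (x : Quotient.quot additive_of).

Lemma qreprK : cancel qrepr qpi. Proof. exact: reprK. Qed.

Lemma qpi_eq x y : (qpi x == qpi y) = (x - y \in S).
Proof. exact: esym (Quotient.idealrBE additive_of x y). Qed.

Lemma qpi_sub x y : qpi (x - y) = qpi x - qpi y.
Proof. exact: (raddfB (\pi_(Quotient.quot additive_of))). Qed.

Lemma qpi_add x y : qpi (x + y) = qpi x + qpi y.
Proof. exact: (raddfD (\pi_(Quotient.quot additive_of))). Qed.

Definition qscale (a : R) (x : quotmod) : quotmod := qpi (a *: qrepr x).

Lemma qpi_scale a x : qpi (a *: x) = qscale a (qpi x).
Proof.
by apply/eqP; rewrite qpi_eq -scalerBr rpredZ // -qpi_eq qreprK.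
Qed.

Fact qscaleA a b x : qscale a (qscale b x) = qscale (a * b) x.
Proof. by rewrite -[x]qreprK -!qpi_scale scalerA. Qed.
Fact qscale1 : left_id 1 qscale.
Proof. by move=> x; rewrite -[x]qreprK -qpi_scale scale1r. Qed.
Fact qscaleDr : right_distributive qscale +%R.
Proof.
move=> a x y; rewrite -[x]qreprK -[y]qreprK -qpi_add -!qpi_scale.
by rewrite scalerDr qpi_add.
Qed.
Fact qscaleDl x : {morph qscale^~ x : a b / a + b}.
Proof. by move=> a b; rewrite -[x]qreprK -!qpi_scale scalerDl qpi_add. Qed.

HB.instance Definition _ :=
  GRing.Zmodule_isLmodule.Build R quotmod qscaleA qscale1 qscaleDr qscaleDl.

Fact qpi_linear : linear qpi.
Proof. by move=> a x y; rewrite qpi_add qpi_scale. Qed.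
HB.instance Definition _ := GRing.isLinear.Build R M quotmod _ qpi qpi_linear.

Lemma qpi_eq0 x : (qpi x == 0) = (x \in S).
Proof. by rewrite -(raddf0 qpi) qpi_eq subr0. Qed.

(* The map induced on M/S by a linear map that vanishes on S. *)
Section Descend.
Variables (P : lmodType R) (f : {linear M -> P}).
Hypothesis f0 : forall x, x \in S -> f x = 0.

Definition qlift (_ : forall x, x \in S -> f x = 0) (x : quotmod) : P :=
  f (qrepr x).

Lemma qliftE x : qlift f0 (qpi x) = f x.
Proof.
by apply/eqP; rewrite /qlift -subr_eq0 -linearB f0 // -qpi_eq qreprK.
Qed.

Fact qlift_linear : linear (qlift f0).
Proof.
move=> a x y; rewrite -[x]qreprK -[y]qreprK.
by rewrite -linearP !qliftE linearP.
Qed.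
HB.instance Definition _ :=
  GRing.isLinear.Build R quotmod P _ (qlift f0) qlift_linear.
End Descend.

End QuotientModule.

Arguments qpi : simpl never.
Arguments qlift : simpl never.

Section TensorProduct.
Variables (R : comNzRingType) (M N : lmodType R).
Local Notation F := {freeg (M * N)%type / R}.

Inductive tensor_relator : F -> Prop :=
| RelDl m m' n :
    tensor_relator (<< (m + m', n) >> - << (m, n) >> - << (m', n) >>)
| RelDr m n n' :
    tensor_relator (<< (m, n + n') >> - << (m, n) >> - << (m, n') >>)
| RelZl (a : R) m n :
    tensor_relator (<< (a *: m, n) >> - a *: << (m, n) >>)
| RelZr (a : R) m n :
    tensor_relator (<< (m, a *: n) >> - a *: << (m, n) >>).

Definition tensor : lmodType R := quotmod (submod_span tensor_relator).

Definition tens (m : M) (n : N) : tensor :=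
  qpi (submod_span tensor_relator) << (m, n) >>.

Lemma tensDl m m' n : tens (m + m') n = tens m n + tens m' n.
Proof.
apply/eqP; rewrite -subr_eq0 opprD addrA -!linearB qpi_eq0.
exact/mem_submod_span/RelDl.
Qed.
Lemma tensDr m n n' : tens m (n + n') = tens m n + tens m n'.
Proof.
apply/eqP; rewrite -subr_eq0 opprD addrA -!linearB qpi_eq0.
exact/mem_submod_span/RelDr.
Qed.
Lemma tensZl a m n : tens (a *: m) n = a *: tens m n.
Proof.
apply/eqP; rewrite -subr_eq0 -linearZ -linearB qpi_eq0.
exact/mem_submod_span/RelZl.
Qed.
Lemma tensZr a m n : tens m (a *: n) = a *: tens m n.
Proof.
apply/eqP; rewrite -subr_eq0 -linearZ -linearB qpi_eq0.
exact/mem_submod_span/RelZr.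
Qed.

Lemma tens0l n : tens 0 n = 0.
Proof. by rewrite -[in LHS](scale0r (0 : M)) tensZl scale0r. Qed.
Lemma tens0r m : tens m 0 = 0.
Proof. by rewrite -[in LHS](scale0r (0 : N)) tensZr scale0r. Qed.

Lemma freeg_linear_ind (P : lmodType R) (f g : {linear F -> P}) :
  (forall z, f << z >> = g << z >>) -> f =1 g.
Proof.
move=> fg x; rewrite -(freeg_sumE x) !linear_sum; apply: eq_bigr => z _ /=.
have -> : << coeff z x *g z >> = coeff z x *: (<< z >> : F).
  by apply/eqP/freeg_eqP => y; rewrite coeffZ !coeffU mul1r.
by rewrite !linearZ_LR /= fg.
Qed.

Lemma tensor_eq (P : lmodType R) (f g : {linear tensor -> P}) :
  (forall m n, f (tens m n) = g (tens m n)) -> f =1 g.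
Proof.
move=> fg x; rewrite -[x]qreprK.
apply: (@freeg_linear_ind _ (f \o qpi _) (g \o qpi _)) => -[m n] /=.
exact: fg.
Qed.

End TensorProduct.

Section TensorLift.
Variables (R : comNzRingType) (M N P : lmodType R) (b : M -> N -> P).
Local Notation F := {freeg (M * N)%type / R}.

Definition bilinear_map (b : M -> N -> P) : Prop :=
  (forall n, linear (b^~ n)) /\ (forall m, linear (b m)).

Definition free_lift (x : F) : P := fglift (fun z => b z.1 z.2) x.

Fact free_lift_additive : zmod_morphism free_lift.
Proof. exact: lift_is_additive. Qed.
HB.instance Definition _ :=
  GRing.isZmodMorphism.Build F P free_lift free_lift_additive.

Lemma free_liftU a m n : free_lift << a *g (m, n) >> = a *: b m n.
Proof. by rewrite /free_lift liftU. Qed.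

Fact free_lift_scalable : scalable free_lift.
Proof.
move=> a x; have lsum (s : seq _) (G : M * N -> F) :
    free_lift (\sum_(z <- s) G z) = \sum_(z <- s) free_lift (G z).
  exact: raddf_sum.
rewrite -[in RHS](freeg_sumE x).
have -> : a *: x = \sum_(z <- dom x) << a * coeff z x *g z >> by [].
rewrite !lsum scaler_sumr; apply: eq_bigr => -[m n] _ /=.
by rewrite !free_liftU scalerA.
Qed.
HB.instance Definition _ :=
  GRing.isScalable.Build R F P _ free_lift free_lift_scalable.


Hypothesis bP : bilinear_map b.

Lemma free_lift0 x : x \in submod_span (@tensor_relator R M N) -> free_lift x = 0.
Proof.
pose K : {pred F} := fun x => free_lift x == 0.
have Kmod : submod_closed K.
  split=> [|a u v]; rewrite /K !unfold_in ?linear0 //.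
  by move=> /eqP u0 /eqP v0; rewrite linearP /= u0 v0 scaler0 addr0.
pose KM := GRing.isSubmodClosed.Build R F K Kmod.
pose KS : submodClosed F := HB.pack K KM.
have [bl br] := bP.
have lU m n : free_lift << (m, n) >> = b m n.
  by rewrite free_liftU scale1r.
move=> /asboolP/(_ KS) xK; apply/eqP; apply: xK => r.
case=> [m m' n|m n n'|a m n|a m n]; apply/eqP;
  rewrite !linearB ?linearZ_LR /= !lU.
- by have := bl n 1 m m'; rewrite !scale1r => ->; rewrite addrAC addrK subrr.
- by have := br m 1 n n'; rewrite !scale1r => ->; rewrite addrAC addrK subrr.
- have b0 : b 0 n = 0.
    by have := bl n (-1) 0 0; rewrite scaler0 addr0 scaleN1r addNr.
  by have := bl n a m 0; rewrite !addr0 b0 addr0 => ->; rewrite scalerN subrr.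
- have b0 : b m 0 = 0.
    by have := br m (-1) 0 0; rewrite scaler0 addr0 scaleN1r addNr.
  by have := br m a n 0; rewrite !addr0 b0 addr0 => ->; rewrite scalerN subrr.
Qed.

Definition tens_lift : tensor M N -> P := qlift free_lift0.
HB.instance Definition _ := GRing.Linear.on tens_lift.

Lemma tens_liftE m n : tens_lift (tens m n) = b m n.
Proof. by rewrite /tens_lift qliftE /= free_liftU scale1r. Qed.

End TensorLift.

Arguments tens_lift : simpl never.

Section TensorMap.
Variables (R : comNzRingType) (M N M' N' : lmodType R).
Variables (f : {linear M -> M'}) (g : {linear N -> N'}).

Fact tens_map_bilinear : bilinear_map (fun m n => tens (f m) (g n)).
Proof.
by split=> [n|m] a x y; rewrite linearP (tensDl, tensDr) (tensZl, tensZr).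
Qed.

Definition tens_map : tensor M N -> tensor M' N' :=
  tens_lift tens_map_bilinear.
HB.instance Definition _ := GRing.Linear.on tens_map.

Lemma tens_mapE m n : tens_map (tens m n) = tens (f m) (g n).
Proof. by rewrite /tens_map tens_liftE. Qed.

End TensorMap.

Arguments tens_map : simpl never.

(* A chain complex on the graded module C.  The boundary C_i -> C_{i-1} is    *)
(* bd i (i - 1); the other components bd i j are required to vanish, so that  *)
(* no transport along equations between degrees is ever needed.               *)
Record complex (R : comNzRingType) (C : int -> lmodType R) := Complex {
  bd : forall i j : int, {linear C i -> C j};
  bd_shape : forall i j x, i != j + 1 -> bd i j x = 0;
  bd_bd : forall i j k x, bd j k (bd i j x) = 0
}.

Record z2complex (R : comNzRingType) (C : int -> lmodType R) := Z2Complex {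
  z2_complex :> complex C;
  z2act : forall i : int, {linear C i -> C i};
  z2actK : forall i, involutive (z2act i);
  z2act_bd : forall i j x,
    bd z2_complex i j (z2act i x) = z2act j (bd z2_complex i j x)
}.

Arguments bd {R C} _ i j.
Arguments z2act {R C} _ i.

Section Homology.
Variables (R : comNzRingType) (C : int -> lmodType R) (K : complex C) (i : int).

Definition is_cycle : {pred C i} := fun x => bd K i (i - 1) x == 0.

Fact cycle_submod : submod_closed is_cycle.
Proof.
split=> [|a u v]; rewrite /is_cycle !unfold_in ?linear0 //.
by move=> /eqP u0 /eqP v0; rewrite linearP u0 v0 scaler0 addr0.
Qed.
HB.instance Definition _ :=
  GRing.isSubmodClosed.Build R (C i) is_cycle cycle_submod.

Definition is_boundary : {pred submod is_cycle} := fun z =>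
  `[< exists x : C (i + 1), \val z = bd K (i + 1) i x >].

Fact boundary_submod : submod_closed is_boundary.
Proof.
split=> [|a u v]; first by apply/asboolP; exists 0; rewrite !linear0.
move=> /asboolP[x ux] /asboolP[y vy]; apply/asboolP; exists (a *: x + y).
by rewrite !linearP /= -ux -vy.
Qed.
HB.instance Definition _ :=
  GRing.isSubmodClosed.Build R (submod is_cycle) is_boundary boundary_submod.

Definition homology : lmodType R := quotmod is_boundary.

End Homology.

(* quotient_complex W e is the quotient of W by {c | c + e z2act(c) = 0}.      *)
Section QuotientComplex.
Variables (R : comNzRingType) (C : int -> lmodType R) (W : z2complex C) (e : R).

Definition twisted (i : int) : {pred C i} := fun c => c + e *: z2act W i c == 0.
Arguments twisted : clear implicits.

Fact twisted_submod i : submod_closed (twisted i).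
Proof.
split=> [|a u v]; rewrite /twisted !unfold_in ?linear0 ?scaler0 ?addr0 //.
move=> /eqP u0 /eqP v0; rewrite linearP scalerDr scalerA mulrC -scalerA.
by rewrite addrACA -scalerDr u0 v0 scaler0 addr0.
Qed.
HB.instance Definition _ i :=
  GRing.isSubmodClosed.Build R (C i) (twisted i) (twisted_submod i).

Definition quotient_module (i : int) : lmodType R := quotmod (twisted i).

Fact quotient_bd0 i j x :
  x \in twisted i -> (qpi (twisted j) \o bd W i j) x = 0.
Proof.
move=> /eqP x0; apply/eqP; rewrite /= qpi_eq0; apply/eqP.
by rewrite -z2act_bd -linearZ -linearD x0 linear0.
Qed.

Definition quotient_bd i j : {linear quotient_module i -> quotient_module j} :=
  qlift (@quotient_bd0 i j) : {linear _ -> _}.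

Lemma quotient_bdE i j x :
  quotient_bd i j (qpi (twisted i) x) = qpi (twisted j) (bd W i j x).
Proof. exact: (qliftE (@quotient_bd0 i j)). Qed.

Fact quotient_shape i j x : i != j + 1 -> quotient_bd i j x = 0.
Proof.
by move=> ij; rewrite -[x]qreprK quotient_bdE bd_shape ?linear0.
Qed.

Fact quotient_bd_bd i j k x : quotient_bd j k (quotient_bd i j x) = 0.
Proof. by rewrite -[x]qreprK !quotient_bdE bd_bd linear0. Qed.

Definition quotient_complex : complex quotient_module :=
  Complex quotient_shape quotient_bd_bd.

End QuotientComplex.

Definition plus_complex (R : comNzRingType) (C : int -> lmodType R)
  (W : z2complex C) := quotient_complex W 1.

Definition minus_complex (R : comNzRingType) (C : int -> lmodType R)
  (W : z2complex C) := quotient_complex W (-1).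

(* The degree k part of the tensor product of two graded modules: the direct  *)
(* sum of V_i (x) W_j over i + j = k, as the module of families indexed by    *)
(* all pairs (i, j), supported on a finite subset of {i + j = k}.             *)
Section GradedTensor.
Variables (R : comNzRingType) (V W : int -> lmodType R) (k : int).

Record graded_tensor : Type := GradedTensor {
  gt_comp :> forall i j : int, tensor (V i) (W j);
  gt_degree : forall i j, i + j != k -> gt_comp i j = 0;
  gt_finite : exists s : seq (int * int),
    forall i j, (i, j) \notin s -> gt_comp i j = 0
}.

Lemma graded_tensorP (x y : graded_tensor) : (forall i j, x i j = y i j) -> x = y.
Proof.
case: x y => [x xd xf] [y yd yf] /= xy.
have exy : x = y.
  apply: functional_extensionality_dep => i.
  by apply: functional_extensionality_dep => j; exact: xy.
by subst y; congr GradedTensor; apply: Prop_irrelevance.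
Qed.

HB.instance Definition _ := gen_eqMixin graded_tensor.
HB.instance Definition _ := gen_choiceMixin graded_tensor.

Program Definition gt_zero : graded_tensor := @GradedTensor (fun _ _ => 0) _ _.
Next Obligation. by []. Qed.
Next Obligation. by exists [::]. Qed.

Program Definition gt_opp (x : graded_tensor) : graded_tensor :=
  @GradedTensor (fun i j => - x i j) _ _.
Next Obligation. by move=> x i j ij; rewrite /= gt_degree ?oppr0. Qed.
Next Obligation.
move=> x; have [s sx] := gt_finite x; exists s => i j ij.
by rewrite /= sx ?oppr0.
Qed.

Program Definition gt_add (x y : graded_tensor) : graded_tensor :=
  @GradedTensor (fun i j => x i j + y i j) _ _.
Next Obligation. by move=> x y i j ij; rewrite /= !gt_degree ?addr0. Qed.
Next Obligation.
move=> x y; have [s sx] := gt_finite x; have [t ty] := gt_finite y.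
exists (s ++ t) => i j; rewrite mem_cat negb_or => /andP[ijs ijt].
by rewrite /= sx ?ty ?addr0.
Qed.

Program Definition gt_scale (a : R) (x : graded_tensor) : graded_tensor :=
  @GradedTensor (fun i j => a *: x i j) _ _.
Next Obligation. by move=> a x i j ij; rewrite /= gt_degree ?scaler0. Qed.
Next Obligation.
move=> a x; have [s sx] := gt_finite x; exists s => i j ij.
by rewrite /= sx ?scaler0.
Qed.

Fact gt_addA : associative gt_add.
Proof. by move=> x y z; apply: graded_tensorP => i j /=; rewrite addrA. Qed.
Fact gt_addC : commutative gt_add.
Proof. by move=> x y; apply: graded_tensorP => i j /=; rewrite addrC. Qed.
Fact gt_add0 : left_id gt_zero gt_add.
Proof. by move=> x; apply: graded_tensorP => i j /=; rewrite add0r. Qed.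
Fact gt_addN : left_inverse gt_zero gt_opp gt_add.
Proof. by move=> x; apply: graded_tensorP => i j /=; rewrite addNr. Qed.
HB.instance Definition _ :=
  GRing.isZmodule.Build graded_tensor gt_addA gt_addC gt_add0 gt_addN.

Fact gt_scaleA a b x : gt_scale a (gt_scale b x) = gt_scale (a * b) x.
Proof. by apply: graded_tensorP => i j /=; rewrite scalerA. Qed.
Fact gt_scale1 : left_id 1 gt_scale.
Proof. by move=> x; apply: graded_tensorP => i j /=; rewrite scale1r. Qed.
Fact gt_scaleDr : right_distributive gt_scale +%R.
Proof. by move=> a x y; apply: graded_tensorP => i j /=; rewrite scalerDr. Qed.
Fact gt_scaleDl x : {morph gt_scale^~ x : a b / a + b}.
Proof. by move=> a b; apply: graded_tensorP => i j /=; rewrite scalerDl. Qed.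
HB.instance Definition _ := GRing.Zmodule_isLmodule.Build R graded_tensor
  gt_scaleA gt_scale1 gt_scaleDr gt_scaleDl.

Lemma gt_comp0 i j : gt_comp (0 : graded_tensor) i j = 0. Proof. by []. Qed.
Lemma gt_compD (x y : graded_tensor) i j : (x + y : graded_tensor) i j = x i j + y i j.
Proof. by []. Qed.
Lemma gt_compZ a (x : graded_tensor) i j : (a *: x : graded_tensor) i j = a *: x i j.
Proof. by []. Qed.

End GradedTensor.

(* The summand inclusion of V_i (x) W_j in degree k; it is 0 if i + j != k.   *)
Section Inclusion.
Variables (R : comNzRingType) (V W : int -> lmodType R) (k i j : int).

Definition incl_fun (t : tensor (V i) (W j)) (i' j' : int) :
    tensor (V i') (W j') :=
  match i =P i', j =P j' with
  | ReflectT ei, ReflectT ej =>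
    if i + j == k
    then ecast n (tensor (V i') (W n)) ej (ecast m (tensor (V m) (W j)) ei t)
    else 0
  | _, _ => 0
  end.

Program Definition incl (t : tensor (V i) (W j)) : graded_tensor V W k :=
  @GradedTensor R V W k (incl_fun t) _ _.
Next Obligation.
rewrite /incl_fun => t i' j'; case: eqP => // ei; case: eqP => // ej.
by subst i' j' => /negPf->.
Qed.
Next Obligation.
move=> t; exists [:: (i, j)] => i' j'; rewrite inE /incl_fun.
by case: eqP => // ei; case: eqP => // ej; subst i' j'; rewrite eqxx.
Qed.

Lemma incl_fun_out (t : tensor (V i) (W j)) i' j' :
  (i != i') || (j != j') -> incl_fun t i' j' = 0.
Proof.
rewrite /incl_fun; case: eqP => // ei; case: eqP => // ej.
Qed.

Lemma incl_fun_id (t : tensor (V i) (W j)) :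
  incl_fun t i j = if i + j == k then t else 0.
Proof.
rewrite /incl_fun; case: eqP => // ei; case: eqP => // ej.
by rewrite (eq_axiomK ei) (eq_axiomK ej).
Qed.

End Inclusion.

Section TensorComplex.
Variables (R : comUnitRingType) (CV CW : int -> lmodType R).

Definition idlin (M : lmodType R) : {linear M -> M} := idfun.

Section Boundary.
Variables (V : complex CV) (W : complex CW).

(* The (i, j) component of the boundary receives the components (i + 1, j)    *)
(* and (i, j + 1).                                                            *)
Definition tensor_bd_comp (k l : int) (x : graded_tensor CV CW k) (i j : int) :
    tensor (CV i) (CW j) :=
  if k == l + 1 then
    tens_map (bd V (i + 1) i) (idlin (CW j)) (x (i + 1) j)
    + (-1) ^ i *: tens_map (idlin (CV i)) (bd W (j + 1) j) (x i (j + 1))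
  else 0.

Program Definition tensor_bd_fun (k l : int) (x : graded_tensor CV CW k) :
    graded_tensor CV CW l :=
  @GradedTensor R CV CW l (tensor_bd_comp l x) _ _.
Next Obligation.
move=> k l x i j ij; rewrite /tensor_bd_comp; case: eqP => // kl.
rewrite !gt_degree ?linear0 ?scaler0 ?addr0 //; first by rewrite addrA kl (inj_eq (addIr _)).
by rewrite addrAC kl (inj_eq (addIr _)).
Qed.
Next Obligation.
move=> k l x; have [s sx] := gt_finite x.
exists ([seq (p.1 - 1, p.2) | p <- s] ++ [seq (p.1, p.2 - 1) | p <- s]).
move=> i j; rewrite mem_cat negb_or => /andP[ij1 ij2].
rewrite /tensor_bd_comp; case: eqP => // _; rewrite !sx ?linear0 ?scaler0 ?addr0 //.
  by apply: contra ij2 => h; apply/mapP; exists (i, j + 1); rewrite ?addrK.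
by apply: contra ij1 => h; apply/mapP; exists (i + 1, j); rewrite ?addrK.
Qed.

Fact tensor_bd_linear k l : linear (@tensor_bd_fun k l).
Proof.
move=> a x y; apply: graded_tensorP => i j; rewrite gt_compD gt_compZ /= /tensor_bd_comp.
case: eqP => _; last by rewrite scaler0 addr0.
rewrite !gt_compD !gt_compZ !linearP /= !scalerDr !scalerA addrACA.
by [].
Qed.
HB.instance Definition _ k l := GRing.isLinear.Build R
  (graded_tensor CV CW k) (graded_tensor CV CW l) _ (@tensor_bd_fun k l)
  (@tensor_bd_linear k l).

Definition tensor_bd k l :
    {linear graded_tensor CV CW k -> graded_tensor CV CW l} :=
  @tensor_bd_fun k l.

Fact tensor_bd_shape k l x : k != l + 1 -> tensor_bd k l x = 0.
Proof.
by move=> /negPf kl; apply: graded_tensorP => i j; rewrite /= /tensor_bd_comp kl.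
Qed.

Fact tensor_bd_bd k l m x : tensor_bd l m (tensor_bd k l x) = 0.
Proof.
apply: graded_tensorP => i j; rewrite /= /tensor_bd_comp /= /tensor_bd_comp.
case: eqP => // lm; case: eqP => kl; last by rewrite !linear0 addr0.
rewrite !linearD !linearZ_LR /=.
set A := tens_map _ _ (tens_map _ _ _); set B := tens_map _ _ (tens_map _ _ _).
set A' := tens_map _ _ (tens_map _ _ _); set B' := tens_map _ _ (tens_map _ _ _).
have -> : A = 0.
  rewrite /A.
  pose f := tens_map (bd V (i + 1) i) (idlin (CW j)).
  pose g := tens_map (bd V (i + 1 + 1) (i + 1)) (idlin (CW j)).
  apply: (@tensor_eq _ _ _ _ (f \o g) \0) => u v /=.
  by rewrite /f /g !tens_mapE bd_bd tens0l.
have -> : B' = 0.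
  rewrite /B'.
  pose f := tens_map (idlin (CV i)) (bd W (j + 1) j).
  pose g := tens_map (idlin (CV i)) (bd W (j + 1 + 1) (j + 1)).
  apply: (@tensor_eq _ _ _ _ (f \o g) \0) => u v /=.
  by rewrite /f /g !tens_mapE bd_bd tens0r.
have -> : A' = B.
  rewrite /A' /B.
  pose f := tens_map (idlin (CV i)) (bd W (j + 1) j).
  pose g := tens_map (bd V (i + 1) i) (idlin (CW (j + 1))).
  pose f' := tens_map (bd V (i + 1) i) (idlin (CW j)).
  pose g' := tens_map (idlin (CV (i + 1))) (bd W (j + 1) j).
  apply: (@tensor_eq _ _ _ _ (f \o g) (f' \o g')) => u v /=.
  by rewrite /f /g /f' /g' !tens_mapE.
rewrite add0r !scaler0 addr0 -scalerDl exprzDr ?unitrN1 // expr1z.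
by rewrite mulrN1 addNr scale0r.
Qed.

Definition tensor_complex : complex (graded_tensor CV CW) :=
  Complex tensor_bd_shape tensor_bd_bd.

End Boundary.

Section Action.
Variables (V : z2complex CV) (W : z2complex CW).

Program Definition tensor_act_fun (k : int) (x : graded_tensor CV CW k) :
    graded_tensor CV CW k :=
  @GradedTensor R CV CW k
    (fun i j => tens_map (z2act V i) (z2act W j) (x i j)) _ _.
Next Obligation. by move=> k x i j ij; rewrite /= gt_degree ?linear0. Qed.
Next Obligation.
move=> k x; have [s sx] := gt_finite x; exists s => i j ij.
by rewrite /= sx ?linear0.
Qed.

Fact tensor_act_linear k : linear (@tensor_act_fun k).
Proof.
by move=> a x y; apply: graded_tensorP => i j; rewrite gt_compD gt_compZ /= linearP.
Qed.
HB.instance Definition _ k := GRing.isLinear.Build R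
  (graded_tensor CV CW k) (graded_tensor CV CW k) _ (@tensor_act_fun k)
  (@tensor_act_linear k).

Definition tensor_act k :
    {linear graded_tensor CV CW k -> graded_tensor CV CW k} :=
  @tensor_act_fun k.

Fact tensor_actK k : involutive (tensor_act k).
Proof.
move=> x; apply: graded_tensorP => i j /=.
pose f := tens_map (z2act V i) (z2act W j).
apply: (@tensor_eq _ _ _ _ (f \o f) (idlin _)) => u v /=.
by rewrite /f !tens_mapE !z2actK.
Qed.

Fact tensor_act_bd k l x :
  tensor_bd V W k l (tensor_act k x) = tensor_act l (tensor_bd V W k l x).
Proof.
apply: graded_tensorP => i j; rewrite /= /tensor_bd_comp /=.
case: eqP => _; last by rewrite linear0.
rewrite linearD linearZ_LR /=; congr (_ + _ *: _).
  pose f := tens_map (bd V (i + 1) i) (idlin (CW j)).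
  pose g := tens_map (z2act V (i + 1)) (z2act W j).
  pose h := tens_map (z2act V i) (z2act W j).
  apply: (@tensor_eq _ _ _ _ (f \o g) (h \o f)) => u v /=.
  by rewrite /f /g /h !tens_mapE z2act_bd.
pose f := tens_map (idlin (CV i)) (bd W (j + 1) j).
pose g := tens_map (z2act V i) (z2act W (j + 1)).
pose h := tens_map (z2act V i) (z2act W j).
apply: (@tensor_eq _ _ _ _ (f \o g) (h \o f)) => u v /=.
by rewrite /f /g /h !tens_mapE z2act_bd.
Qed.

Definition tensor_z2complex : z2complex (graded_tensor CV CW) :=
  @Z2Complex R (graded_tensor CV CW) (tensor_complex V W)
    tensor_act tensor_actK tensor_act_bd.

Lemma tensor_bd_incl k i j (v : CV i) (w : CW j) : i + j = k ->
  bd tensor_z2complex k (k - 1) (incl k (tens v w)) =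
  incl (k - 1) (tens (bd V i (i - 1) v) w)
  + (-1) ^ i *: incl (k - 1) (tens v (bd W j (j - 1) w)).
Proof.
move=> ijk; apply: graded_tensorP => i' j'.
rewrite gt_compD gt_compZ /= /tensor_bd_comp subrK eqxx /=; congr (_ + _).
  have [ei|ni] := eqVneq i (i' + 1); last first.
    rewrite !incl_fun_out ?linear0 ?ni //.
    by apply/orP; left; apply: contra ni => /eqP <-; rewrite subrK.
  have [ej|nj] := eqVneq j j'; last by rewrite !incl_fun_out ?linear0 ?nj ?orbT.
  subst i j'; rewrite incl_fun_id ijk eqxx tens_mapE.
  have en := addrK 1 i'; move: (i' + 1 - 1) en => n en; subst n.
  by rewrite incl_fun_id -ijk addrAC addrK eqxx.
have [ei|ni] := eqVneq i i'; last first.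
  by rewrite !incl_fun_out ?linear0 ?scaler0 ?ni.
have [ej|nj] := eqVneq j (j' + 1); last first.
  rewrite !incl_fun_out ?linear0 ?scaler0 ?nj ?orbT //.
  by apply/orP; right; apply: contra nj => /eqP <-; rewrite subrK.
subst i' j; rewrite incl_fun_id ijk eqxx tens_mapE; congr (_ *: _).
have en := addrK 1 j'; move: (j' + 1 - 1) en => n en; subst n.
by rewrite incl_fun_id -ijk addrA addrK eqxx.
Qed.

Lemma tensor_act_incl k i j (v : CV i) (w : CW j) :
  z2act tensor_z2complex k (incl k (tens v w)) =
  incl k (tens (z2act V i v) (z2act W j w)).
Proof.
apply: graded_tensorP => i' j' /=; rewrite /incl_fun.
case: eqP => [ei|_]; last by rewrite linear0.
case: eqP => [ej|_]; last by rewrite linear0.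
case: i' / ei; case: j' / ej => /=.
by case: eqP => _; rewrite ?linear0 ?tens_mapE.
Qed.

End Action.
End TensorComplex.

Section Hemispherical.
Variables (R : comUnitRingType) (D : nat).

Definition hemi_rank (i : int) : nat := if 0 <= i <= D%:Z then 2%N else 0%N.

Definition hemi_module (i : int) : lmodType R := 'rV[R]_(hemi_rank i).

(* sigma i false and sigma i true are the generators sigma_i^+ and sigma_i^-  *)
(* for 0 <= i <= D; in the other degrees both are 0.                          *)
Definition sigma (i : int) (e : bool) : hemi_module i :=
  \row_(a < hemi_rank i) (a == e :> nat)%:R.

Definition hemi_bd_mx (i j : int) : 'M[R]_(hemi_rank i, hemi_rank j) :=
  if i == j + 1 then
    \matrix_(a < hemi_rank i)
      (sigma j (odd a) + (-1) ^ i *: sigma j (~~ odd a))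
  else 0.

Definition hemi_act_mx (i : int) : 'M[R]_(hemi_rank i) :=
  \matrix_(a < hemi_rank i) sigma i (~~ odd a).

Definition hemi_bd (i j : int) (x : hemi_module i) : hemi_module j :=
  x *m hemi_bd_mx i j.
HB.instance Definition _ i j :=
  GRing.Linear.copy (@hemi_bd i j) (mulmxr (hemi_bd_mx i j)).

Definition hemi_act (i : int) (x : hemi_module i) : hemi_module i :=
  x *m hemi_act_mx i.
HB.instance Definition _ i :=
  GRing.Linear.copy (@hemi_act i) (mulmxr (hemi_act_mx i)).

Arguments hemi_bd : clear implicits.
Arguments hemi_act : clear implicits.

Lemma sigma_mul (i : int) (n : nat) (e : bool) (F : bool -> 'rV[R]_n) :
  0 <= i <= D%:Z ->
  sigma i e *m (\matrix_(a < hemi_rank i) F (odd a)) = F e.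
Proof.
move=> iD; have r2 : hemi_rank i = 2%N by rewrite /hemi_rank iD.
have er : (e < hemi_rank i)%N by rewrite r2; case: (e).
have -> : sigma i e = delta_mx 0 (Ordinal er).
  by apply/rowP => a; rewrite !mxE eqxx.
by rewrite -rowE rowK /=; case: (e).
Qed.

Lemma hemi_bd_sigma (i : int) (e : bool) : 0 <= i <= D%:Z ->
  hemi_bd i (i - 1) (sigma i e) =
  sigma (i - 1) e + (-1) ^ i *: sigma (i - 1) (~~ e).
Proof.
move=> iD; rewrite /hemi_bd /hemi_bd_mx /= subrK eqxx.
exact: (sigma_mul e (fun b => sigma (i - 1) b + (-1) ^ i *: sigma (i - 1) (~~ b))).
Qed.

Lemma hemi_act_sigma (i : int) (e : bool) : 0 <= i <= D%:Z ->
  hemi_act i (sigma i e) = sigma i (~~ e).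
Proof. exact: (sigma_mul e (fun b => sigma i (~~ b))). Qed.

Lemma hemi_eq (M : lmodType R) (i : int) (f g : {linear hemi_module i -> M}) :
  (0 <= i <= D%:Z -> forall e, f (sigma i e) = g (sigma i e)) -> f =1 g.
Proof.
move=> fg x; rewrite (row_sum_delta x) !linear_sum; apply: eq_bigr => a _ /=.
rewrite !linearZ_LR /=; congr (_ *: _).
have iD : 0 <= i <= D%:Z.
  by case: a => a; rewrite /hemi_rank; case: ifP.
suff -> : delta_mx 0 a = sigma i (odd a) by exact: fg.
apply/rowP => b; rewrite !mxE eqxx /=; congr (nat_of_bool _)%:R.
rewrite -val_eqE /=; congr (_ == _).
have r2 : hemi_rank i = 2%N by rewrite /hemi_rank iD.
by case: a => /= a; rewrite r2; case: a => [|[|]].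
Qed.

Fact hemi_shape i j x : i != j + 1 -> hemi_bd i j x = 0.
Proof. by rewrite /hemi_bd /hemi_bd_mx /= => /negPf ->; rewrite mulmx0. Qed.

Fact hemi_bd_bd i j k x : hemi_bd j k (hemi_bd i j x) = 0.
Proof.
have [ij|] := eqVneq i (j + 1); last first.
  by move=> ij; rewrite (hemi_shape x ij) linear0.
have [jk|] := eqVneq j (k + 1); last exact: hemi_shape.
have [jD|jD] := boolP (0 <= j <= D%:Z); last first.
  suff -> : hemi_bd i j x = 0 by rewrite linear0.
  apply/rowP => -[b /= hb]; exfalso; move: hb.
  by rewrite /hemi_rank (negPf jD).
have {}jk : k = j - 1 by rewrite jk addrK.
have {}ij : j = i - 1 by rewrite ij addrK.
subst k j.
apply: (hemi_eq (f := hemi_bd (i - 1) (i - 1 - 1) \o hemi_bd i (i - 1))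
                (g := \0)) => iD e /=.
rewrite hemi_bd_sigma // linearD linearZ_LR /= !hemi_bd_sigma //.
rewrite negbK scalerDr scalerA -exprzDr ?unitrN1 //.
have ii : (-1) ^ i * (-1) ^ i = 1 :> R.
  rewrite -exprzDr ?unitrN1 // -mulr2n -[i *+ 2]mulr_natl -exprz_exp.
  by rewrite [(-1) ^ _]sqrrN expr1n exp1rz.
rewrite !exprzDr ?unitrN1 // mulrA ii mul1r [_ ^ (-1)]invrN1 mulrN1.
by rewrite scaleN1r scaleNr addrA subrK subrr.
Qed.

Definition hemi_complex : complex hemi_module :=
  Complex hemi_shape hemi_bd_bd.

Fact hemi_actK i : involutive (hemi_act i).
Proof.
apply: (hemi_eq (f := hemi_act i \o hemi_act i) (g := idlin _)) => iD e /=.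
by rewrite !hemi_act_sigma ?negbK.
Qed.

Fact hemi_act_bd i j x :
  bd hemi_complex i j (hemi_act i x) = hemi_act j (bd hemi_complex i j x).
Proof.
rewrite /=; have [ij|ij] := eqVneq i (j + 1); last first.
  by rewrite !hemi_shape ?linear0.
have {}ij : j = i - 1 by rewrite ij addrK.
subst j.
apply: (hemi_eq (f := hemi_bd i (i - 1) \o hemi_act i)
                (g := hemi_act (i - 1) \o hemi_bd i (i - 1))) => iD e /=.
rewrite hemi_act_sigma // !hemi_bd_sigma // linearD linearZ_LR /=.
have [jD|jD] := boolP (0 <= i - 1 <= D%:Z).
  by rewrite !hemi_act_sigma.
by apply/rowP => -[b /= hb]; exfalso; move: hb; rewrite /hemi_rank (negPf jD).
Qed.

Definition hemispherical : z2complex hemi_module :=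
  @Z2Complex R hemi_module hemi_complex hemi_act hemi_actK hemi_act_bd.

End Hemispherical.

(* Main.v *)
(* W^+ and W^- are copies of the graded module L, and folding                 *)
(* sigma^e (x) w to iota^e w identifies (V (x) W)^+_k with the sum of the     *)
(* W_{k-m}, 0 <= m <= D.  With N_m = 1 + (-1)^m iota its boundary is          *)
(*   (dx)_m = N_{m+1} x_{m+1} + (-1)^m bd x_m.                                *)
(* The rows (N_m)_m are exact, except at m = 0 and m = D, where they          *)
(* contribute W^+ and W^e, e = (-1)^(D+1).  The projection r onto W^+ is      *)
(* x |-> [x_0].  For the other one let b be the off-diagonal block of bd, and *)
(*   y_0 = 0,  y_{m+1} = b y_m - (-1)^m (x_m).2;                              *)
(* then q x = [(y_{D+1}, 0)] commutes with the boundaries up to sign, because *)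
(* the obstruction factors through b^(D+1), which vanishes for degree         *)
(* reasons.  Moreover h x = ((y_m, 0))_m satisfies dh = id on the cycles of   *)
(* the kernel of (r, q), so (r, q) is onto with acyclic kernel.               *)

From HB Require Import structures.
Require Import Defs.
From mathcomp Require Import all_boot all_order all_algebra.
From mathcomp Require Import ssrAC zify boolp.

Set Implicit Arguments.
Unset Strict Implicit.
Unset Printing Implicit Defensive.

Import Order.TTheory GRing.Theory Num.Theory.
Local Open Scope ring_scope.

(** Folding turns (V (x) W)^+ into D+1 shifted copies of W joined by the maps 1 + iota and 1 - iota
    alternately. Since iota swaps the factors of L x L, these rows are exact in the middle, and only
    their ends survive: W^+ at index 0 and W^e, with e = (-1)^(D+1), at index D. As in a Gysin
    sequence, the obstruction to splitting the two ends is a map lowering degree by D+1. Here it is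
    the power [bd_off]^(D+1) ([defectS]), which is zero because L lives in degrees 0 to D
    ([defect_top]).

    Concretely, the projections [r] and [q] to the ends respect boundaries ([r_bd], and [q_bd] up to
    sign), are jointly onto ([lift]) and have acyclic joint kernel ([acyclic]); [homology_prod]
    turns this into the isomorphism on homology. *)

(** * Isomorphisms of modules *)

Lemma first_isomorphism (R : nzRingType) (M P : lmodType R) (S : submodClosed M)
    (f : {linear M -> P}) :
  (forall x, f x = 0 <-> x \in S) -> (forall p, exists x, f x = p) ->
  (quotmod S : lmodType R) ~= P.
Proof.
move=> ker_f f_onto.
have f0 x : x \in S -> f x = 0 by move/ker_f.
exists (qlift f0 : {linear _ -> _}).
have [g gK] := choice f_onto.
exists (fun p => qpi S (g p)) => [x|p] /=; last by rewrite qliftE.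
rewrite -[x]qreprK qliftE; apply/eqP; rewrite qpi_eq.
by apply/ker_f; rewrite linearB gK subrr.
Qed.

Lemma isomorphic_refl (R : nzRingType) (M : lmodType R) : M ~= M.
Proof. by exists (idfun : {linear M -> M}); exists idfun. Qed.

Lemma isomorphic_prod0r (R : nzRingType) (M N : lmodType R) :
  (forall y : N, y = 0) -> ((M * N)%type : lmodType R) ~= M.
Proof.
move=> N0; exists (fst : {linear (M * N)%type -> M}).
by exists (fun x => (x, 0)) => [[x y]|x] //=; rewrite (N0 y).
Qed.

Lemma isomorphic_prod0l (R : nzRingType) (M N : lmodType R) :
  (forall x : M, x = 0) -> ((M * N)%type : lmodType R) ~= N.
Proof.
move=> M0; exists (snd : {linear (M * N)%type -> N}).
by exists (fun y => (0, y)) => [[x y]|y] //=; rewrite (M0 x).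
Qed.

Lemma isomorphic_rV0 (R : nzRingType) (M : lmodType R) :
  (forall x : M, x = 0) -> M ~= ('rV[R]_0 : lmodType R).
Proof.
move=> M0; exists (\0 : {linear M -> 'rV[R]_0}).
by exists (fun _ => 0) => [x|y]; [rewrite [RHS]M0 | apply/rowP => -[]].
Qed.

(** * Homology as a product, from a pair of maps *)

Section HomologyProduct.
Variables (R : comNzRingType) (C C1 C2 : int -> lmodType R).
Variables (K : complex C) (K1 : complex C1) (K2 : complex C2).
Variables (k k1 k2 : int).
Variables (r : {linear C k -> C1 k1}) (q : {linear C k -> C2 k2}).

Local Notation cycle K k x := (bd K k (k - 1) x = 0).
Local Notation boundary K k x := (exists y, x = bd K (k + 1) k y).

Hypothesis r_cycle : forall x, cycle K k x -> cycle K1 k1 (r x).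
Hypothesis q_cycle : forall x, cycle K k x -> cycle K2 k2 (q x).
Hypothesis r_boundary : forall x, boundary K k x -> boundary K1 k1 (r x).
Hypothesis q_boundary : forall x, boundary K k x -> boundary K2 k2 (q x).
Hypothesis cycle_lift : forall u v, cycle K1 k1 u -> cycle K2 k2 v ->
  exists x, [/\ cycle K k x, r x = u & q x = v].
Hypothesis boundary_lift : forall x, cycle K k x ->
  boundary K1 k1 (r x) -> boundary K2 k2 (q x) -> boundary K k x.

Let cycle_val (z : submod (@is_cycle R C K k)) : cycle K k (\val z).
Proof. exact/eqP/(valP z). Qed.

Let r_is_cycle (z : submod (@is_cycle R C K k)) :
  r (\val z) \in @is_cycle R C1 K1 k1.
Proof. exact/eqP/r_cycle/cycle_val. Qed.

Let q_is_cycle (z : submod (@is_cycle R C K k)) :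
  q (\val z) \in @is_cycle R C2 K2 k2.
Proof. exact/eqP/q_cycle/cycle_val. Qed.

Let classes (z : submod (@is_cycle R C K k)) :
    (homology K1 k1 * homology K2 k2)%type :=
  (qpi (@is_boundary R C1 K1 k1) (Sub (r (\val z)) (r_is_cycle z)),
   qpi (@is_boundary R C2 K2 k2) (Sub (q (\val z)) (q_is_cycle z))).

Let classes_linear : linear classes.
Proof.
move=> a x y; rewrite /classes; apply/pair_equal_spec; split=> /=.
  by rewrite -[RHS]linearP; congr (qpi _ _); apply: val_inj; apply: linearP.
by rewrite -[RHS]linearP; congr (qpi _ _); apply: val_inj; apply: linearP.
Qed.

(** Only cycles and boundaries enter the hypotheses, so [r] and [q] may commute with the boundaries
    merely up to sign. Injectivity on homology is [boundary_lift], surjectivity is [cycle_lift]. *)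
Lemma homology_prod :
  homology K k ~= ((homology K1 k1 * homology K2 k2)%type : lmodType R).
Proof.
pose f : {linear _ -> _} := HB.pack classes
  (GRing.isLinear.Build R _ _ _ classes classes_linear).
apply: (first_isomorphism (f := f)) => [z|[u v]].
  split=> [/pair_equal_spec[/= ru qv]|zb].
    apply/asboolP/boundary_lift; first exact: cycle_val.
      by move/eqP: ru; rewrite qpi_eq0 => /asboolP.
    by move/eqP: qv; rewrite qpi_eq0 => /asboolP.
  move/asboolP: zb => zb; congr pair; apply/eqP; rewrite qpi_eq0; apply/asboolP.
    exact: r_boundary.
  exact: q_boundary.
have [||x [xc ru qv]] := @cycle_lift (\val (qrepr u)) (\val (qrepr v)).
- exact/eqP/(valP (qrepr u)).
- exact/eqP/(valP (qrepr v)).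
exists (Sub x (introT eqP xc)); rewrite /= /classes -[u]qreprK -[v]qreprK.
by congr (qpi _ _, qpi _ _); apply: val_inj; rewrite !SubK.
Qed.

End HomologyProduct.

(** * Folding (V (x) W)^+ onto copies of W *)

Section HemisphericalTensor.
Variables (R : comUnitRingType) (D : nat).
Local Notation V := (hemispherical R D).
Local Notation HM := (hemi_module R D).

Lemma hemi_module_out (i : int) (v : HM i) : ~~ (0 <= i <= D%:Z) -> v = 0.
Proof.
by move=> iD; apply/rowP => -[b /= hb]; exfalso; move: hb;
  rewrite /hemi_rank (negPf iD).
Qed.

Lemma sigmaE (i : int) (e : bool) (a : 'I_(hemi_rank D i)) :
  sigma R D i e 0 a = (odd a == e)%:R.
Proof.
rewrite mxE; congr (nat_of_bool _)%:R; case: a => a.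
by rewrite /= /hemi_rank; case: ifP => _; case: a => [|[|]] //; case: e.
Qed.

Section Fold.
Variables (N P : lmodType R) (f g : {linear N -> P}) (i : int).

Let fold_term (v : HM i) (w : N) : P :=
  \sum_(a < hemi_rank D i) v 0 a *: (if odd a then g w else f w).

Fact fold_term_bilinear : bilinear_map fold_term.
Proof.
split=> [w|v] c x y; rewrite /fold_term scaler_sumr -big_split;
  apply: eq_bigr => a _ /=.
  by rewrite !mxE scalerDl scalerA.
by case: ifP => _; rewrite linearP scalerDr !scalerA mulrC.
Qed.

(** The maps applied at sigma^+ and sigma^- are left free: [fold] takes the identity and iota, while
    [fold_eq0] also needs the identity and 0. *)
Definition hemi_fold : tensor (HM i) N -> P := tens_lift fold_term_bilinear.
HB.instance Definition _ := GRing.Linear.on hemi_fold.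

Lemma hemi_fold_sigma e w : 0 <= i <= D%:Z ->
  hemi_fold (tens (sigma R D i e) w) = if e then g w else f w.
Proof.
move=> iD; rewrite /hemi_fold tens_liftE /fold_term.
have r2 : hemi_rank D i = 2%N by rewrite /hemi_rank iD.
under eq_bigr do rewrite sigmaE.
rewrite r2 !big_ord_recl big_ord0 /= addr0.
by case: e; rewrite ?scale1r ?scale0r ?add0r ?addr0.
Qed.

Lemma hemi_tensor_eq (F G : {linear tensor (HM i) N -> P}) :
  (0 <= i <= D%:Z -> forall e w,
    F (tens (sigma R D i e) w) = G (tens (sigma R D i e) w)) -> F =1 G.
Proof.
move=> FG; apply: tensor_eq => v w.
pose tw : HM i -> tensor (HM i) N := fun v => tens v w.
have tw_linear : linear tw by move=> c x y; rewrite /tw tensDl tensZl.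
pose t : {linear HM i -> tensor (HM i) N} := HB.pack tw
  (GRing.isLinear.Build R _ _ _ tw tw_linear).
by apply: (hemi_eq (f := F \o t) (g := G \o t)) => iD e; exact: FG.
Qed.

End Fold.

Section Quotient.
Variables (CW : int -> lmodType R) (W : z2complex CW).
Local Notation VW := (tensor_z2complex V W).

(* The class of sigma_i^e (x) w in (V (x) W)^+ is that of                     *)
(* sigma_i^+ (x) fold w, so that (V (x) W)^+ is a sum of copies of W.         *)
Definition fold (i j : int) : {linear tensor (HM i) (CW j) -> CW j} :=
  hemi_fold (idlin (CW j)) (z2act W j) (i := i).

Lemma fold_sigma i j e w : 0 <= i <= D%:Z ->
  fold i j (tens (sigma R D i e) w) = if e then z2act W j w else w.
Proof. exact: hemi_fold_sigma. Qed.

Lemma fold_out i j t : ~~ (0 <= i <= D%:Z) -> fold i j t = 0.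
Proof.
by move=> iD; apply: (hemi_tensor_eq (G := \0)) => iD'; rewrite iD' in iD.
Qed.

(** The bound on i excludes i = -1, where the left side is 0 but the right side is a nontrivial 1 +
    iota. At i = D both sides are 0. *)
Lemma fold_bdl (i j : int) t : 0 <= i ->
  fold i j (tens_map (bd V (i + 1) i) (idlin (CW j)) t) =
  fold (i + 1) j t - (-1) ^ i *: z2act W j (fold (i + 1) j t).
Proof.
move=> i0.
pose F := fold i j \o tens_map (bd V (i + 1) i) (idlin (CW j)).
pose G := fold (i + 1) j \+ (- (-1) ^ i : R) \*: (z2act W j \o fold (i + 1) j).
rewrite -scaleNr; apply: (hemi_tensor_eq (F := F) (G := G)) => iD e w.
rewrite /F /G /= tens_mapE /=.
have iD' : 0 <= i <= D%:Z.
  by rewrite i0; case/andP: iD => _; apply: le_trans; rewrite lerDl.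
have := hemi_bd_sigma R e iD.
have en := addrK 1 i; move: (i + 1 - 1) en => n en; subst n => ->.
rewrite tensDl tensZl linearD linearZ_LR /= !fold_sigma //.
rewrite exprzDr ?unitrN1 // expr1z mulrN1.
by case: e => /=; rewrite ?z2actK.
Qed.

Lemma fold_bdr (i j : int) t :
  fold i j (tens_map (idlin (HM i)) (bd W (j + 1) j) t) =
  bd W (j + 1) j (fold i (j + 1) t).
Proof.
pose F := fold i j \o tens_map (idlin (HM i)) (bd W (j + 1) j).
pose G := bd W (j + 1) j \o fold i (j + 1).
apply: (hemi_tensor_eq (F := F) (G := G)) => iD e w.
rewrite /F /G /= tens_mapE /= !fold_sigma //.
by case: e => //; rewrite z2act_bd.
Qed.

Lemma fold_act (i j : int) t :
  t + tens_map (z2act V i) (z2act W j) t =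
  tens (sigma R D i false) (fold i j t)
  + tens (sigma R D i true) (z2act W j (fold i j t)).
Proof.
pose tp e : CW j -> tensor (HM i) (CW j) := tens (sigma R D i e).
have tp_linear e : linear (tp e) by move=> c x y; rewrite /tp tensDr tensZr.
pose T e : {linear CW j -> tensor (HM i) (CW j)} := HB.pack (tp e)
  (GRing.isLinear.Build R _ _ _ (tp e) (tp_linear e)).
pose F := idlin (tensor (HM i) (CW j)) \+ tens_map (z2act V i) (z2act W j).
pose G := (T false \o fold i j) \+ (T true \o z2act W j \o fold i j).
apply: (hemi_tensor_eq (F := F) (G := G)) => iD e w.
rewrite /F /G /= /tp tens_mapE /= hemi_act_sigma // !fold_sigma //.
by case: e => //=; rewrite z2actK addrC.
Qed.

(** By [fold_act], t + iota(t) depends only on the fold of t; conversely its sigma^+ coefficient is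
    that fold. *)
Lemma fold_eq0 (i j : int) t :
  (fold i j t == 0) = (t + tens_map (z2act V i) (z2act W j) t == 0).
Proof.
rewrite fold_act; have [iD|iD] := boolP (0 <= i <= D%:Z); last first.
  rewrite fold_out // !(hemi_module_out (sigma _ _ _ _)) //.
  by rewrite !tens0l addr0 !eqxx.
apply/eqP/eqP => [->|]; first by rewrite linear0 !tens0r addr0.
move=> /(congr1 (hemi_fold (idlin (CW j)) (\0 : {linear CW j -> CW j}) (i := i))).
by rewrite linear0 linearD /= !hemi_fold_sigma //= addr0.
Qed.

Lemma plus_tensor_eq0 k (x : graded_tensor HM CW k) :
  (qpi (twisted VW 1 (i := k)) x = 0) <-> forall i j, fold i j (x i j) = 0.
Proof.
split=> [/eqP|x0].
  rewrite qpi_eq0 => /eqP; rewrite scale1r => x0 i j; apply/eqP.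
  by rewrite fold_eq0; apply/eqP; rewrite -(gt_comp0 HM CW k i j) -x0.
apply/eqP; rewrite qpi_eq0; apply/eqP; rewrite scale1r.
apply: graded_tensorP => i j; rewrite gt_compD gt_comp0.
by apply/eqP; rewrite -fold_eq0 x0.
Qed.

Lemma fold_bd k l (x : graded_tensor HM CW k) (i j : int) : k = l + 1 -> 0 <= i ->
  fold i j (bd VW k l x i j) =
  fold (i + 1) j (x (i + 1) j)
  - (-1) ^ i *: z2act W j (fold (i + 1) j (x (i + 1) j))
  + (-1) ^ i *: bd W (j + 1) j (fold i (j + 1) (x i (j + 1))).
Proof.
move=> /eqP kl i0; rewrite /= /tensor_bd_comp kl linearD linearZ_LR.
by rewrite fold_bdl // fold_bdr.
Qed.

End Quotient.
End HemisphericalTensor.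

(** * The swap action: block form of the boundary, primitives and their defect *)

Section SwapComplex.
Variables (R : comUnitRingType) (L : int -> lmodType R).
Variable W : z2complex (fun j : int => (L j * L j)%type : lmodType R).
Hypothesis W_swap : forall (j : int) (w : L j * L j), z2act W j w = (w.2, w.1).

(* The boundary of W commutes with the swap, so it is the block matrix        *)
(* [[bd_diag, bd_off], [bd_off, bd_diag]].                                    *)
Definition bd_diag (i j : int) (u : L i) : L j := (bd W i j (u, 0)).1.
Definition bd_off (i j : int) (u : L i) : L j := (bd W i j (u, 0)).2.

Arguments bd_diag : clear implicits.
Arguments bd_off : clear implicits.

Let inl_linear c (i : int) (u v : L i) :
  (c *: u + v, 0) = c *: (u, 0) + (v, 0) :> (L i * L i)%type.
Proof. by apply/pair_equal_spec; rewrite /= scaler0 addr0. Qed.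

Fact bd_diag_linear i j : linear (bd_diag i j).
Proof. by move=> c u v; rewrite /bd_diag inl_linear linearP. Qed.
HB.instance Definition _ i j :=
  GRing.isLinear.Build R (L i) (L j) _ (bd_diag i j) (@bd_diag_linear i j).

Fact bd_off_linear i j : linear (bd_off i j).
Proof. by move=> c u v; rewrite /bd_off inl_linear linearP. Qed.
HB.instance Definition _ i j :=
  GRing.isLinear.Build R (L i) (L j) _ (bd_off i j) (@bd_off_linear i j).

Lemma bd_swapE i j (w : L i * L i) :
  bd W i j w =
  (bd_diag i j w.1 + bd_off i j w.2, bd_off i j w.1 + bd_diag i j w.2).
Proof.
case: w => u v /=.
have -> : (u, v) = (u, 0) + z2act W i (v, 0) :> (L i * L i)%type.
  by rewrite W_swap; apply/pair_equal_spec; rewrite /= addr0 add0r.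
by rewrite linearD /= z2act_bd W_swap.
Qed.

(** This is the second coordinate of bd (bd (u, 0)) = 0. *)
Lemma bd_diag_off i j k (u : L i) :
  bd_diag j k (bd_off i j u) = - bd_off j k (bd_diag i j u).
Proof.
have := @bd_bd _ _ W i j k (u, 0) => /(congr1 snd).
rewrite [bd W i j _]surjective_pairing bd_swapE /= => /eqP.
by rewrite addrC addr_eq0 => /eqP.
Qed.

(** As e * e = 1, the second coordinate of c + e iota(c) is e times the first, so w |-> w.1 + e w.2
    identifies W^e with L. *)
Lemma quotient_eq (e : R) (i : int) (w w' : L i * L i) : e * e = 1 ->
  (qpi (twisted W e (i := i)) w = qpi (twisted W e (i := i)) w') <->
  w.1 + e *: w.2 = w'.1 + e *: w'.2.
Proof.
move=> ee; split=> [/eqP|ww'].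
  rewrite qpi_eq => /eqP; rewrite W_swap => /(congr1 fst) /= /eqP.
  by rewrite scalerBr addrACA -opprD subr_eq0 => /eqP.
apply/eqP; rewrite qpi_eq; apply/eqP; rewrite W_swap.
have ww0 : (w.1 - w'.1) + e *: (w.2 - w'.2) = 0.
  by rewrite scalerBr addrACA -opprD ww' subrr.
apply/pair_equal_spec; split=> //=.
by rewrite -[X in X + _]scale1r -ee -scalerA -scalerDr addrC ww0 scaler0.
Qed.

(* The sum of (-1)^(m'+1) bd_off^(m-1-m') (Z m') over m' < m.                 *)
Fixpoint primitive (Z : nat -> forall j, L j) (m : nat) (j : int) : L j :=
  if m is m'.+1
  then bd_off (j + 1) j (primitive Z m' (j + 1)) - (-1) ^+ m' *: Z m' j
  else 0.

Lemma primitive_linear c (Z Z' Z'' : nat -> forall j, L j) m j :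
  (forall m j, Z'' m j = c *: Z m j + Z' m j) ->
  primitive Z'' m j = c *: primitive Z m j + primitive Z' m j.
Proof.
move=> ZE; elim: m j => [|m IH] j /=; first by rewrite scaler0 addr0.
rewrite IH ZE linearP /= !scalerDr !scalerA scalerN scalerA [_ * c]mulrC.
by rewrite opprD addrACA.
Qed.

Lemma primitive_eq0 (Z : nat -> forall j, L j) n m j :
  (forall m j, (m < n)%N -> Z m j = 0) -> (m <= n)%N -> primitive Z m j = 0.
Proof.
move=> Z0; elim: m j => [|m IH] j //= mn.
by rewrite IH ?(ltnW mn) // Z0 // linear0 scaler0 subr0.
Qed.

Lemma primitive_supp (Z : nat -> forall j, L j) (k : int) m j :
  (forall (m : nat) j, m%:Z + j != k -> Z m j = 0) ->
  m%:Z + j != k + 1 -> primitive Z m j = 0.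
Proof.
move=> Z0; elim: m j => [|m IH] j //= mjk.
rewrite intS in mjk; rewrite IH ?Z0 ?linear0 ?scaler0 ?subr0 ?addr0 //.
  by apply: contra mjk => /eqP <-; rewrite -addrA addrC.
by rewrite addrA addrC addrA.
Qed.

Section Defect.
Variables X X' : nat -> forall j, L j * L j.
Hypothesis X'E : forall m j, X' m j = X m.+1 j
  - (-1) ^+ m *: z2act W j (X m.+1 j) + (-1) ^+ m *: bd W (j + 1) j (X m (j + 1)).
Let y := primitive (fun m j => (X m j).2).
Let y' := primitive (fun m j => (X' m j).2).

(* With h x = ((y_m, 0))_m this is the failure of (dh + hd) x = x at index m, *)
(* in the first coordinate.  By defectS it is bd_off^m applied to its value   *)
(* at index 0.                                                                *)
Definition defect (m : nat) (j : int) : L j :=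
  y m.+1 j + (-1) ^+ m *: bd_diag (j + 1) j (y m (j + 1)) + y' m j - (X m j).1.

Lemma defect0 j : defect 0 j = - ((X 0 j).1 + (X 0 j).2).
Proof.
rewrite /defect /y /y' /= !linear0 expr0 !scale1r sub0r !addr0.
by rewrite opprD addrC.
Qed.

(** Expand [y], [y'] and [X'] by their recursions and move [bd_diag] past [bd_off] with
    [bd_diag_off]; the terms that do not come from the defect at m cancel. *)
Lemma defectS m j : defect m.+1 j = bd_off (j + 1) j (defect m (j + 1)).
Proof.
have yS n i : y n.+1 i =
    bd_off (i + 1) i (y n (i + 1)) - (-1) ^+ n *: (X n i).2.
  by [].
have y'S n i : y' n.+1 i =
    bd_off (i + 1) i (y' n (i + 1)) - (-1) ^+ n *: (X' n i).2.
  by [].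
rewrite /defect; move: (y) (y') yS y'S => u u' uS u'S.
rewrite [u m.+2 j]uS u'S X'E W_swap bd_swapE /=.
rewrite [in bd_diag _ _ (u m.+1 _)]uS [bd_diag _ _ (_ - _)]linearB /=.
rewrite [bd_diag _ _ (_ *: _)]linearZ_LR /= bd_diag_off.
rewrite [bd_off _ _ (_ - _)]linearB /= [bd_off _ _ (_ + _)]linearD /=.
rewrite [bd_off _ _ (_ + _)]linearD /=.
rewrite [bd_off _ _ (_ *: _)]linearZ_LR /=.
move: (bd_off _ _ (u m.+1 _)) (bd_off _ _ (bd_diag _ _ _)) => A B.
move: (bd_off _ _ (u' m _)) => Y; move: (bd_off _ _ _) (bd_diag _ _ _) => Q P.
rewrite exprS mulN1r.
have ss : (-1) ^+ m * (-1) ^+ m = 1 :> R by rewrite -expr2 sqrr_sign.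
move: ((-1) ^+ m) ss => s ss; rewrite !scaleNr !opprK.
rewrite !(scalerBr, scalerDr, scalerN) !scalerA ss !scale1r !opprD !opprK !addrA.
(* The last three groups are the cancelling pairs. *)
rewrite [LHS](ACl (1 * 3 * 5 * 8 * (2 * 6) * (4 * 9) * (7 * 10))) /=.
by rewrite !subrr !addr0.
Qed.

End Defect.
End SwapComplex.

Arguments bd_diag {R L} W i j u.
Arguments bd_off {R L} W i j u.

Section DefectVanishing.
Variables (R : comUnitRingType) (L : int -> lmodType R).
Variable W : z2complex (fun j : int => (L j * L j)%type : lmodType R).
Hypothesis W_swap : forall (j : int) (w : L j * L j), z2act W j w = (w.2, w.1).
Variables X X' : nat -> forall j, L j * L j.
Hypothesis X'E : forall m j, X' m j = X m.+1 j
  - (-1) ^+ m *: z2act W j (X m.+1 j) + (-1) ^+ m *: bd W (j + 1) j (X m (j + 1)).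

Lemma defect_eq0 m j :
  (forall j, (X 0 j).1 + (X 0 j).2 = 0) -> defect W X X' m j = 0.
Proof.
move=> X0; elim: m j => [|m IH] j; first by rewrite defect0 X0 oppr0.
by rewrite (defectS W_swap X'E) IH linear0.
Qed.

(** For j >= 0 the value comes, through D+1 applications of [bd_off], from degree j+D+1, where L is
    zero; for j < 0 its target L_j is zero. *)
Lemma defect_top (D : nat) j :
  (forall j : int, ~~ (0 <= j <= D%:Z) -> forall x : L j, x = 0) ->
  defect W X X' D.+1 j = 0.
Proof.
move=> L_supp; have d0 m i : D%:Z < m%:Z + i -> defect W X X' m i = 0.
  elim: m i => [|m IH] i Di.
    by apply: L_supp; rewrite negb_and orbC -ltNge -[i]add0r Di.
  rewrite (defectS W_swap X'E) IH ?linear0 //.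
  by move: Di; rewrite intS -addrA addrC -addrA.
have [j0|j0] := leP 0 j; last by apply: L_supp; rewrite negb_and -ltNge j0.
by apply: d0; rewrite intS -addrA addrC -addrA ltrDl ltzD1.
Qed.

End DefectVanishing.

(** * The projections [r] and [q] to the two ends, and the contraction of their kernel *)

Section PlusTensorHomology.
Variables (R : comUnitRingType) (D : nat) (L : int -> lmodType R).
Variable W : z2complex (fun j : int => (L j * L j)%type : lmodType R).
Hypothesis L_supp : forall j : int, ~~ (0 <= j <= D%:Z) -> forall x : L j, x = 0.
Hypothesis W_swap : forall (j : int) (w : L j * L j), z2act W j w = (w.2, w.1).
Variable e : R.
Hypothesis eE : e = (-1) ^+ D.+1.

Local Notation V := (hemispherical R D).
Local Notation VW := (tensor_z2complex V W).
Local Notation GT := (graded_tensor (hemi_module R D)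
  (fun j : int => (L j * L j)%type : lmodType R)).
Local Notation K := (plus_complex VW).
Local Notation Kp := (plus_complex W).
Local Notation Ke := (quotient_complex W e).
Local Notation piVW k := (qpi (twisted VW 1 (i := k))).
Local Notation pip k := (qpi (twisted W 1 (i := k))).
Local Notation pie k := (qpi (twisted W e (i := k))).

Let ee : e * e = 1. Proof. by rewrite eE -expr2 sqrr_sign. Qed.

Let folds k (x : GT k) (m : nat) (j : int) : L j * L j := fold D W m j (x m j).

Let prim k (x : GT k) := primitive W (fun m j => (folds x m j).2).

Let primS k (x : GT k) m j :
  prim x m.+1 j =
  bd_off W (j + 1) j (prim x m (j + 1)) - (-1) ^+ m *: (folds x m j).2.
Proof. by []. Qed.

Let folds_linear k m j : linear (fun x : GT k => folds x m j).
Proof. by move=> c x y; rewrite /folds gt_compD gt_compZ linearP. Qed.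

Let prim_linear k m j : linear (fun x : GT k => prim x m j).
Proof.
by move=> c x y; apply: primitive_linear => n i; rewrite folds_linear.
Qed.

Let folds_bd k l (x : GT k) m j : k = l + 1 ->
  folds (bd VW k l x) m j = folds x m.+1 j
  - (-1) ^+ m *: z2act W j (folds x m.+1 j)
  + (-1) ^+ m *: bd W (j + 1) j (folds x m (j + 1)).
Proof.
move=> kl; rewrite /folds (fold_bd _ _ _ kl) //.
by rewrite (_ : m%:Z + 1 = m.+1%:Z) // intS addrC.
Qed.

Let folds_out k (x : GT k) m j : (D < m)%N -> folds x m j = 0.
Proof. by move=> Dm; apply: fold_out; rewrite negb_and orbC -ltNge ltz_nat Dm. Qed.

Let folds_supp k (x : GT k) m j : m%:Z + j != k -> folds x m j = 0.
Proof. by move=> mjk; rewrite /folds gt_degree // linear0. Qed.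

Let prim_supp k (x : GT k) m j : m%:Z + j != k + 1 -> prim x m j = 0.
Proof.
by apply: primitive_supp => n i nik; rewrite folds_supp.
Qed.

Let piVW_eq0 k (x : GT k) :
  piVW k x = 0 <-> forall m j, folds x m j = 0.
Proof.
split=> [/plus_tensor_eq0 x0 m j|x0]; first exact: x0.
apply/plus_tensor_eq0 => -[m|m] j; first exact: x0.
by rewrite fold_out.
Qed.

Let r_pre k (x : GT k) := pip k (folds x 0 k).
Let r_pre_linear k : linear (@r_pre k).
Proof. by move=> c x y; rewrite /r_pre folds_linear linearP. Qed.
Let r_lin k : {linear GT k -> quotient_module W 1 k} := HB.pack (@r_pre k)
  (GRing.isLinear.Build R _ _ _ (@r_pre k) (@r_pre_linear k)).
Let r_pre0 k x : x \in twisted VW 1 (i := k) -> r_lin k x = 0.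
Proof.
move=> xt; have x0 : piVW k x = 0 by apply/eqP; rewrite qpi_eq0.
by rewrite /r_lin /= /r_pre (piVW_eq0 x).1 // linear0.
Qed.
Let r k : {linear quotient_module VW 1 k -> quotient_module W 1 k} :=
  qlift (@r_pre0 k) : {linear _ -> _}.

(** Keeping [l] independent of [k] avoids transport between degrees; [prim x D.+1 l] vanishes unless
    l = k - D. *)
Let q_pre k l (x : GT k) := pie l (prim x D.+1 l, 0).
Let q_pre_linear k l : linear (@q_pre k l).
Proof.
move=> c x y; rewrite /q_pre prim_linear -linearP; congr (qpi _ _).
by apply/pair_equal_spec; rewrite /= scaler0 addr0.
Qed.
Let q_lin k l : {linear GT k -> quotient_module W e l} := HB.pack (@q_pre k l)
  (GRing.isLinear.Build R _ _ _ (@q_pre k l) (@q_pre_linear k l)).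
Let q_pre0 k l x : x \in twisted VW 1 (i := k) -> q_lin k l x = 0.
Proof.
move=> xt; have x0 : piVW k x = 0 by apply/eqP; rewrite qpi_eq0.
have y0 : prim x D.+1 l = 0.
  by apply: primitive_eq0 (leqnn _) => m j _; rewrite (piVW_eq0 x).1.
by rewrite /q_lin /= /q_pre y0 linear0.
Qed.
Let q k l : {linear quotient_module VW 1 k -> quotient_module W e l} :=
  qlift (@q_pre0 k l) : {linear _ -> _}.

Let rE k x : r k (piVW k x) = pip k (folds x 0 k).
Proof. exact: (qliftE (@r_pre0 k)). Qed.

Let qE k l x : q k l (piVW k x) = pie l (prim x D.+1 l, 0).
Proof. exact: (qliftE (@q_pre0 k l)). Qed.

(** The term (1 - iota) x_1 of the boundary at index 0 has coordinates of sum 0, so it dies in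
    W^+. *)
Let r_bd k k' x : k = k' + 1 -> r k' (bd K k k' x) = bd Kp k k' (r k x).
Proof.
move=> kk'; rewrite -[x]qreprK; move: (qrepr x) => {}x; subst k.
rewrite [bd K _ _ _]quotient_bdE !rE [bd Kp _ _ _]quotient_bdE.
apply/(quotient_eq W_swap); first exact: mulr1.
rewrite folds_bd // expr0 !scale1r W_swap /=.
by rewrite addrACA subrKA subrr add0r.
Qed.

(** Folds vanish at index D+1, so [defect_top] reads y'_{D+1} = -(bd_off + e bd_diag) y_{D+1}, which
    is (-1)^D times the boundary of W^e in the coordinate of [quotient_eq]. *)
Let q_bd k k' l l' x : k = k' + 1 -> l = l' + 1 ->
  q k' l' (bd K k k' x) = (-1) ^+ D *: bd Ke l l' (q k l x).
Proof.
move=> kk' ll'; rewrite -[x]qreprK; move: (qrepr x) => {}x; subst k l.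
rewrite [bd K _ _ _]quotient_bdE !qE [bd Ke _ _ _]quotient_bdE -linearZ.
apply/(quotient_eq W_swap) => //.
rewrite (bd_swapE W_swap) /= scaler0 addr0 !linear0 !addr0 scalerA.
have := defect_top W_swap (fun m j => folds_bd x m j erefl) l' L_supp.
rewrite /defect -/(prim x) -/(prim _) folds_out // subr0.
rewrite primS folds_out // scaler0 subr0 => /eqP.
rewrite addrC addr_eq0 => /eqP ->.
rewrite eE exprS !mulN1r mulNr -expr2 sqrr_sign scaleN1r scaleNr opprD opprK.
by rewrite addrC.
Qed.

Let elt k (m : nat) l (w : L l * L l) : GT k :=
  @incl R (hemi_module R D) (fun j : int => (L j * L j)%type : lmodType R) k m l
    (tens (sigma R D m false) w).

Let folds_elt k m l w : (m <= D)%N -> m%:Z + l = k ->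
  folds (@elt k m l w) m l = w.
Proof. by move=> mD mlk; rewrite /folds /= incl_fun_id mlk eqxx fold_sigma. Qed.

Let folds_elt_out k m l w n j : n != m -> folds (@elt k m l w) n j = 0.
Proof.
by move=> nm; rewrite /folds /= incl_fun_out ?linear0 // eqz_nat eq_sym nm.
Qed.

(** Place u at index 0 with second coordinate 0, so that it does not affect the primitive, and v at
    index D as (c, e c), which contributes -(-1)^D e c = c to y_{D+1}. *)
Let lift k l u v : l + D%:Z = k -> exists x, r k x = u /\ q k l x = v.
Proof.
move=> lDk; rewrite -[u]qreprK -[v]qreprK.
move: (qrepr u) (qrepr v) => {}u {}v.
pose c := v.1 + e *: v.2.
pose x0 : GT k := elt k 0 (u.1 + u.2, 0 : L k).
pose xD : GT k := elt k D (c, e *: c).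
have foldsD m j : folds (x0 + xD) m j = folds x0 m j + folds xD m j.
  by have := folds_linear m j 1 x0 xD; rewrite !scale1r.
have x0k : folds x0 0 k = (u.1 + u.2, 0) by apply: folds_elt; rewrite ?add0r.
have xDl : folds xD D l = (c, e *: c) by apply: folds_elt; rewrite // addrC.
have x02 m j : (folds x0 m j).2 = 0.
  have [->|m0] := eqVneq m 0%N; last by rewrite folds_elt_out.
  have [->|jk] := eqVneq j k; first by rewrite x0k.
  by rewrite folds_supp // add0r.
exists (piVW k (x0 + xD)); split.
  rewrite rE; apply/(quotient_eq W_swap); first exact: mulr1.
  rewrite foldsD x0k !scale1r /= add0r -addrA -[RHS]addr0; congr (_ + _).
  (* For D = 0 both elements sit at index 0, but then e = -1 and (c, -c) is zero in W^+. *)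
  have [D0|D0] := posnP D; last by rewrite folds_elt_out ?addr0 // eq_sym -lt0n.
  have xD0 m j : m = D -> j = l -> (folds xD m j).1 + (folds xD m j).2 = 0.
    by move=> -> ->; rewrite xDl /= eE D0 expr1 scaleN1r subrr.
  by rewrite xD0 // -lDk D0 addr0.
have primD : prim (x0 + xD) D.+1 l = c.
  rewrite primS; have -> : prim (x0 + xD) D (l + 1) = 0.
    apply: primitive_eq0 (leqnn _) => m j mD.
    by rewrite foldsD /= x02 folds_elt_out ?addr0 // neq_ltn mD.
  rewrite foldsD xDl /= x02 add0r linear0 sub0r eE exprS mulN1r scaleNr scalerN.
  by rewrite scalerA -expr2 sqrr_sign scale1r opprK.
by rewrite qE primD; apply/(quotient_eq W_swap) => //=; rewrite scaler0 addr0.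
Qed.

(** The absolute value is harmless, since sigma is 0 in negative degrees. *)
Let homotopy_fun k (x : GT k) (i j : int) :=
  tens (sigma R D i false) (prim x `|i| j, 0 : L j).

Let homotopy_out k (x : GT k) (i j : int) :
  ~~ (0 <= i <= D%:Z) -> homotopy_fun x i j = 0.
Proof.
by move=> iD; rewrite /homotopy_fun (hemi_module_out (sigma _ _ _ _)) // tens0l.
Qed.

Let homotopy_degree k (x : GT k) (i j : int) :
  i + j != k + 1 -> homotopy_fun x i j = 0.
Proof.
case: i => m ijk; last exact: homotopy_out.
by rewrite /homotopy_fun prim_supp // tens0r.
Qed.

Let homotopy_finite k (x : GT k) : exists s : seq (int * int),
  forall i j, (i, j) \notin s -> homotopy_fun x i j = 0.
Proof.
exists [seq (m%:Z, k + 1 - m%:Z) | m <- iota 0 D.+1] => i j ijs.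
have [iD|iD] := boolP (0 <= i <= D%:Z); last exact: homotopy_out.
apply: homotopy_degree; apply: contra ijs => /eqP <-.
case: i iD => // m mD; apply/mapP; exists m; first by rewrite mem_iota.
by rewrite addrAC subrr add0r.
Qed.

Let homotopy k (x : GT k) : GT (k + 1) :=
  @GradedTensor R (hemi_module R D)
    (fun j : int => (L j * L j)%type : lmodType R) (k + 1)
    (homotopy_fun x) (homotopy_degree x) (homotopy_finite x).

Let folds_homotopy k (x : GT k) m j : (m <= D)%N ->
  folds (homotopy x) m j = (prim x m j, 0).
Proof. by move=> mD; rewrite /folds /= fold_sigma. Qed.

(** From r x = 0 the defect vanishes at every index, and dx = 0 kills y'; what is left of the defect
    says that dh x and x agree in the first coordinate. In the second they agree by the recursion of
    [prim]. *)
Let acyclic k k' k'' l x : k = k'' + 1 -> k' = k + 1 -> l + D%:Z = k ->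
  bd K k k'' x = 0 -> r k x = 0 -> q k l x = 0 ->
  exists y, [/\ bd K k' k y = x, r k' y = 0 & forall l', q k' l' y = 0].
Proof.
move=> kk'' -> lDk; rewrite -[x]qreprK; move: (qrepr x) => {}x.
rewrite [bd K _ _ _]quotient_bdE => /piVW_eq0 dx0.
rewrite rE -(linear0 (pip k)) => /(quotient_eq W_swap) r0.
rewrite qE -(linear0 (pie l)) => /(quotient_eq W_swap) q0.
have {}r0 j : (folds x 0 j).1 + (folds x 0 j).2 = 0.
  have [->|jk] := eqVneq j k; last by rewrite folds_supp ?add0r ?addr0.
  by have := r0 (mulr1 1); rewrite !scale1r addr0.
have {}q0 j : prim x D.+1 j = 0.
  have [->|jl] := eqVneq j l; first by have := q0 ee; rewrite /= !scaler0 !addr0.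
  apply: prim_supp; apply: contra jl => /eqP; rewrite intS -lDk -addrA addrC.
  by move=> /addIr; rewrite addrC => /addIr ->.
have dprim m j : prim (bd VW k k'' x) m j = 0.
  by apply: primitive_eq0 (leqnn _) => n i _; rewrite dx0.
have x1 m j : prim x m.+1 j + (-1) ^+ m *: bd_diag W (j + 1) j (prim x m (j + 1))
    = (folds x m j).1.
  have := defect_eq0 W_swap (fun m j => folds_bd x m j kk'') m j r0.
  rewrite /defect -/(prim x) -/(prim _) dprim addr0 => /eqP.
  by rewrite subr_eq0 => /eqP.
(* The boundary at index D needs m = D+1 as well: there the fold is 0 by position, and y_{D+1} is 0
   because q x = 0. *)
have hE m j : (m <= D.+1)%N -> folds (homotopy x) m j = (prim x m j, 0).
  rewrite leq_eqVlt => /predU1P[->|]; last exact: folds_homotopy.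
  by rewrite folds_out // q0.
exists (piVW (k + 1) (homotopy x)); split=> [||l'].
- rewrite [bd K _ _ _]quotient_bdE; apply/eqP; rewrite -subr_eq0 -linearB.
  apply/eqP/piVW_eq0 => m j.
  have -> : folds (bd VW (k + 1) k (homotopy x) - x) m j =
      folds (bd VW (k + 1) k (homotopy x)) m j - folds x m j.
    by rewrite addrC -scaleN1r folds_linear scaleN1r addrC.
  apply/eqP; rewrite subr_eq0; apply/eqP.
  have [mD|Dm] := leqP m D; last by rewrite !folds_out.
  rewrite folds_bd // !hE ?(leqW mD) // W_swap [RHS]surjective_pairing.
  rewrite [bd W _ _ _]surjective_pairing; apply/pair_equal_spec; split=> /=.
    by rewrite scaler0 subr0 x1.
  rewrite -/(bd_off W (j + 1) j _) sub0r primS scalerBr opprB.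
  by rewrite scalerA -expr2 sqrr_sign scale1r subrK.
- by rewrite rE hE //; exact: (linear0 (pip (k + 1))).
(* The folds of [homotopy x] have second coordinate 0, so its own primitive vanishes. *)
- have h0 : prim (homotopy x) D.+1 l' = 0.
    by apply: primitive_eq0 (leqnn _) => m j mD; rewrite hE // ltnW.
  by rewrite qE h0; exact: (linear0 (pie l')).
Qed.

(** The usual chase for an onto map with acyclic kernel: lift, then correct by the chain that
    [acyclic] provides. *)
Theorem homology_plus_tensor (k : int) :
  homology K k ~= ((homology Kp k * homology Ke (k - D%:Z))%type : lmodType R).
Proof.
set l := k - D%:Z; have lDk : l + D%:Z = k by rewrite subrK.
have k1 : k = k - 1 + 1 by rewrite subrK.
have l1 : l = l - 1 + 1 by rewrite subrK.
have lD1 : l - 1 + D%:Z = k - 1 by rewrite addrAC lDk.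
have lDS : l + 1 + D%:Z = k + 1 by rewrite addrAC lDk.
apply: (homology_prod (r := r k) (q := q k l)).
- by move=> x xc; rewrite -r_bd // xc linear0.
- move=> x xc; have := q_bd x k1 l1; rewrite xc linear0.
  move=> /esym/(congr1 ( *:%R ((-1) ^+ D))).
  by rewrite scalerA -expr2 sqrr_sign scale1r scaler0.
- by move=> x [y ->]; exists (r (k + 1) y); rewrite r_bd.
- move=> x [y ->]; exists ((-1) ^+ D *: q (k + 1) (l + 1) y).
  by rewrite (q_bd _ erefl erefl) linearZ.
- move=> u v uc vc; have [x [xu xv]] := lift u v lDk.
  (* The boundary of the lift x is a cycle of the kernel, hence bounds some y of the kernel, and x -
     y is a cycle with the same images. *)
  have dd : bd K (k - 1) (k - 1 - 1) (bd K k (k - 1) x) = 0 by apply: bd_bd.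
  have rd : r (k - 1) (bd K k (k - 1) x) = 0 by rewrite r_bd // xu.
  have qd : q (k - 1) (l - 1) (bd K k (k - 1) x) = 0.
    by rewrite (q_bd _ k1 l1) xv vc scaler0.
  have [y [dy ry qy]] := acyclic (esym (subrK _ _)) k1 lD1 dd rd qd.
  by exists (x - y); rewrite !linearB /= dy ry qy subrr !subr0 xu xv.
- move=> x xc [u xu] [v xv].
  (* The factor (-1)^D cancels the sign in [q_bd]. *)
  have [z [zu zv]] := lift u ((-1) ^+ D *: v) lDS.
  pose x' := x - bd K (k + 1) k z.
  have dx' : bd K k (k - 1) x' = 0.
    have dd : bd K k (k - 1) (bd K (k + 1) k z) = 0 by apply: bd_bd.
    by rewrite linearB xc dd subr0.
  have rx' : r k x' = 0 by rewrite linearB /= xu r_bd // zu subrr.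
  have qx' : q k l x' = 0.
    have sv : bd Ke (l + 1) l ((-1) ^+ D *: v) = (-1) ^+ D *: bd Ke (l + 1) l v.
      exact: linearZ.
    rewrite linearB (q_bd _ erefl erefl) zv sv scalerA -expr2 sqrr_sign scale1r.
    by rewrite xv subrr.
  have [y [dy _ _]] := acyclic k1 erefl lDk dx' rx' qx'.
  by exists (z + y); rewrite linearD /= dy addrC subrK.
Qed.

End PlusTensorHomology.

(** * Vanishing outside degrees 0 to D and the case distinction *)

Lemma homology_quotient_eq0 (R : comNzRingType) (C : int -> lmodType R)
    (W : z2complex C) (e : R) (i : int) :
  (forall x : C i, x = 0) -> forall h : homology (quotient_complex W e) i, h = 0.
Proof.
move=> C0 h; rewrite -[h]qreprK; apply/eqP; rewrite qpi_eq0.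
suff -> : qrepr h = 0 by exact: rpred0.
by apply: val_inj; rewrite -[LHS]qreprK (C0 (qrepr (\val (qrepr h)))) linear0.
Qed.

(** The second factor vanishes for i < D and the first for i > D. *)
Lemma support_split (R : nzRingType) (D : nat) (H H' : int -> lmodType R)
    (i : int) :
  (forall j : int, ~~ (0 <= j <= D%:Z) -> forall x : H j, x = 0) ->
  (forall j : int, ~~ (0 <= j <= D%:Z) -> forall x : H' j, x = 0) ->
  ((H i * H' (i - D%:Z))%type : lmodType R) ~=
    (if 0 <= i <= D%:Z - 1 then H i
     else if i == D%:Z then (H D%:Z * H' 0)%type : lmodType R
     else if D%:Z + 1 <= i <= 2 * D%:Z then H' (i - D%:Z)
     else 'rV[R]_0 : lmodType R).
Proof.
move=> H0 H'0; case: ifP => [iD|iD]; first by apply/isomorphic_prod0r/H'0; lia.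
case: eqP => [->|/eqP niD]; first by rewrite subrr; exact: isomorphic_refl.
case: ifP => [iDD|iDD]; first by apply/isomorphic_prod0l/H0; lia.
apply: isomorphic_rV0 => -[x y].
by rewrite (H0 i _ x) ?(H'0 (i - D%:Z) _ y) //; lia.
Qed.

Theorem theorem4p12 (R : idomainType) (R_pid : principal_ideal_domain R)
  (c : nat) (R_char : has_characteristic R c) (c_odd_or_0 : odd c \/ c = 0%N)
  (D : nat) (L : int -> lmodType R)
  (L_fg : forall j : int, finitely_generated (L j))
  (L_supp : forall j : int, ~~ (0 <= j <= D%:Z) -> forall x : L j, x = 0)
  (W : z2complex (fun j : int => (L j * L j)%type : lmodType R))
  (W_swap : forall (j : int) (w : L j * L j), z2act W j w = (w.2, w.1))
  (i : int) :
  let V := hemispherical R D in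
  let VW := tensor_z2complex V W in
  let H_VW := homology (plus_complex VW) in
  let Hp := homology (plus_complex W) in
  let Hm := homology (minus_complex W) in
  (odd D ->
     (H_VW i ~= ((Hp i * Hp (i - D%:Z))%type : lmodType R)) /\
     (((Hp i * Hp (i - D%:Z))%type : lmodType R) ~=
        (if 0 <= i <= D%:Z - 1 then Hp i
         else if i == D%:Z then (Hp D%:Z * Hp 0)%type : lmodType R
         else if D%:Z + 1 <= i <= 2 * D%:Z then Hp (i - D%:Z)
         else 'rV[R]_0 : lmodType R)))
  /\
  (~~ odd D ->
     (H_VW i ~= ((Hp i * Hm (i - D%:Z))%type : lmodType R)) /\
     (((Hp i * Hm (i - D%:Z))%type : lmodType R) ~=
        (if 0 <= i <= D%:Z - 1 then Hp i
         else if i == D%:Z then (Hp D%:Z * Hm 0)%type : lmodType R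
         else if D%:Z + 1 <= i <= 2 * D%:Z then Hm (i - D%:Z)
         else 'rV[R]_0 : lmodType R))).
Proof.
move=> V VW H_VW Hp Hm.
have H0 e (j : int) : ~~ (0 <= j <= D%:Z) ->
    forall h : homology (quotient_complex W e) j, h = 0.
  move=> jD; apply: homology_quotient_eq0 => -[u v].
  by rewrite (L_supp j jD u) (L_supp j jD v).
have splitting e : e = (-1) ^+ D.+1 -> homology (plus_complex VW) i ~=
    ((Hp i * homology (quotient_complex W e) (i - D%:Z))%type : lmodType R).
  by move=> eE; exact: (homology_plus_tensor L_supp W_swap eE i).
split=> D_parity; split; try by apply: support_split => j; apply: H0.
  by apply: splitting; rewrite -signr_odd /= D_parity.
by apply: splitting; rewrite -signr_odd /= D_parity.
Qed.
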